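(* Let $(X_i)_{i \in \mathbb{N}}$ be a sequence of metric spaces $X_i = (X_i,d_i)$, let $n \ge 1$, and suppose that for every $L \ge 1$ there exists $D=D(L) \ge 0$ such that every $X_i$ satisfies $(\mathrm{SS}_n)$ with constant $D$, that is: for every $i\in\mathbb{N}$ and every $a\ge0$, if $\Delta$ is a Euclidean $(n+1)$-simplex and $f \colon \partial\Delta \to X_i$ is a map whose restriction to each facet of $\Delta$ is an $(L,a)$-quasi-isometric embedding, then the image of every facet is within distance at most $D(1 + a)$ of the union of the images of the remaining ones. Then the sequence $(X_i)_{i \in \mathbb{N}}$ has asymptotic rank $\le n$.
   Context: A map $f\colon W\to X$ between metric spaces is an $(L,a)$-quasi-isometric embedding ($L\ge1$, $a\ge0$) if $L^{-1}d(x,y)-a\le d(f(x),f(y))\le L\,d(x,y)+a$ for all $x,y\in W$ (no continuity is assumed). A facet of an $(n+1)$-simplex is a (closed) $n$-dimensional face. A set $A$ is within distance at most $t$ from $B$ if every point of $A$ has distance at most $t$ from $B$. Asymptotic rank of a sequence of metric spaces $X_i=(X_i,d_i)$: a compact metric space $\Omega$ is an asymptotic subset of $(X_i)_{i\in\mathbb{N}}$ if there exist positive numbers $r_i\to\infty$ and subsets $Y_i\subset X_i$ such that $(Y_i,r_i^{-1}d_i)$ converges to $\Omega$ in the Gromov–Hausdorff topology. The asymptotic rank of $(X_i)$ is the supremum of all $k\ge0$ such that there exists an asymptotic subset bi-Lipschitz homeomorphic to a compact subset of $\mathbb{R}^k$ with positive Lebesgue measure. *)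

(* Defs.v *)
From HB Require Import structures.
From mathcomp Require Import all_boot all_order all_algebra.
From mathcomp Require Import all_classical all_reals all_analysis.

Set Implicit Arguments.
Unset Strict Implicit.
Unset Printing Implicit Defensive.

Import Order.TTheory GRing.Theory Num.Theory.
Import numFieldNormedType.Exports.

Local Open Scope classical_set_scope.
Local Open Scope ring_scope.

(* The library norm on 'rV[R]_k is the sup norm, so the Euclidean distance is
   introduced separately. *)
Definition eucl_dist (R : realType) (k : nat) (x y : 'rV[R]_k) : R :=
  Num.sqrt (\sum_(i < k) (x 0 i - y 0 i) ^+ 2).

(* Only the values of f and dW on the domain W matter. *)
Definition qi_embedding (R : realType) (L a : R) (S : Type) (W : set S)
    (dW : S -> S -> R) (X : metricType R) (f : S -> X) : Prop :=
  forall x y, W x -> W y ->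
    L^-1 * dW x y - a <= mdist (f x) (f y) <= L * dW x y + a.

(* edist_inf B x is the infimum of the distances from x to the points of B. *)
Definition within_distance (R : realType) (X : metricType R) (t : R)
    (A B : set X) : Prop :=
  forall x, A x -> (edist_inf B x <= t%:E)%E.

Definition affinely_independent (R : realType) (N m : nat)
    (v : 'I_m -> 'rV[R]_N) : Prop :=
  forall c : 'I_m -> R, \sum_i c i = 0 -> \sum_i c i *: v i = 0 ->
    forall i, c i = 0.

(* The face opposite to the vertex v j in the simplex with vertices v. *)
Definition facet (R : realType) (N m : nat) (v : 'I_m -> 'rV[R]_N)
    (j : 'I_m) : set 'rV[R]_N :=
  [set x | exists c : 'I_m -> R,
    [/\ forall i, 0 <= c i, c j = 0, \sum_i c i = 1 & x = \sum_i c i *: v i]].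

(* The condition (SS_n) for a fixed L, with constant D.  An (n+1)-simplex is
   given by n+2 affinely independent points of some R^N.  Its boundary is the
   union of its facets; a map defined on it is represented by a total function
   f, whose values off the boundary are irrelevant. *)
Definition SS (R : realType) (n : nat) (L D : R) (X : metricType R) : Prop :=
  forall (a : R) (N : nat) (v : 'I_n.+2 -> 'rV[R]_N) (f : 'rV[R]_N -> X),
    0 <= a -> affinely_independent v ->
    (forall j, qi_embedding L a (facet v j) (@eucl_dist R N) f) ->
    forall j, within_distance (D * (1 + a)) (f @` facet v j)
      (\bigcup_(i in [set i | i != j]) f @` facet v i).

Definition hausdorff_dist (R : realType) (Z : metricType R) (A B : set Z) :
    \bar R :=
  ereal_inf [set e%:E | e in [set e : R |
    [/\ 0 <= e, within_distance e A B & within_distance e B A]]].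

Definition isometric_on (R : realType) (S : Type) (A : set S)
    (dA : S -> S -> R) (Z : metricType R) (phi : S -> Z) : Prop :=
  forall x y, A x -> A y -> mdist (phi x) (phi y) = dA x y.

(* The Gromov-Hausdorff distance between (A, dA) and (B, dB): the infimum, over
   all isometric embeddings into a common metric space, of the Hausdorff
   distance of the images. *)
Definition gh_dist (R : realType) (S T : Type) (A : set S) (dA : S -> S -> R)
    (B : set T) (dB : T -> T -> R) : \bar R :=
  ereal_inf [set h | exists (Z : metricType R) (phi : S -> Z) (psi : T -> Z),
    [/\ isometric_on A dA phi, isometric_on B dB psi
      & h = hausdorff_dist (phi @` A) (psi @` B)]].

Definition asymptotic_subset (R : realType) (X : nat -> metricType R)
    (Omega : metricType R) : Prop :=
  compact [set: Omega] /\
  exists (r : nat -> R) (Y : forall i, set (X i)),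
    [/\ forall i, 0 < r i,
        r i @[i --> \oo] --> +oo
      & gh_dist (Y i) (fun x y => (r i)^-1 * mdist x y)
          [set: Omega] (@mdist R Omega) @[i --> \oo] --> 0%:E].

(* Lebesgue outer measure on R^k, which is the Lebesgue measure on measurable
   sets, in particular on compact ones: the infimum of the total volume of the
   countable (possibly finite) covers by closed boxes.  The index set J makes
   finite covers available even for k = 0, where every box has volume 1, so
   that a point of R^0 has measure 1. *)
Definition box (R : realType) (k : nat) (a b : 'rV[R]_k) : set 'rV[R]_k :=
  [set x | forall i, a 0 i <= x 0 i <= b 0 i].

Definition box_volume (R : realType) (k : nat) (a b : 'rV[R]_k) : R :=
  \prod_(i < k) (b 0 i - a 0 i).

Definition lebesgue_outer (R : realType) (k : nat) (A : set 'rV[R]_k) :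
    \bar R :=
  ereal_inf [set s | exists (J : set nat) (a b : nat -> 'rV[R]_k),
    [/\ forall j i, a j 0 i <= b j 0 i,
        A `<=` \bigcup_(j in J) box (a j) (b j)
      & s = \esum_(j in J) (box_volume (a j) (b j))%:E]].

(* A bi-Lipschitz map is automatically a homeomorphism onto its image. *)
Definition bilipschitz_onto (R : realType) (Omega : metricType R) (k : nat)
    (K : set 'rV[R]_k) (g : Omega -> 'rV[R]_k) : Prop :=
  g @` [set: Omega] = K /\
  exists2 C : R, 1 <= C & forall x y,
    C^-1 * mdist x y <= eucl_dist (g x) (g y) <= C * mdist x y.

Definition asymptotic_rank (R : realType) (X : nat -> metricType R) : \bar R :=
  ereal_sup [set (k%:R)%:E | k in [set k : nat |
    exists (Omega : metricType R) (K : set 'rV[R]_k) (g : Omega -> 'rV[R]_k),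
      [/\ asymptotic_subset X Omega, compact K,
          (0 < lebesgue_outer K)%E & bilipschitz_onto K g]]].

(* Main.v *)
Require Import Defs.
From HB Require Import structures.
From mathcomp Require Import all_boot all_order all_algebra.
From mathcomp Require Import all_classical all_reals all_analysis.
From mathcomp Require Import ring lra.

(** The conclusion is scale sensitive: in a simplex of size t whose facets are
    (L, a)-quasi-isometrically embedded, the barycentre of one facet is at
    distance of order t from the other facets, so its image is at distance at
    least of order t / L - a from their images, whereas [SS] only allows
    D (1 + a).  Hence a must be at least a fixed fraction of t, up to a bounded
    error.  This is [SS_cube_scale].

    Suppose that the asymptotic rank exceeds n.  Then some asymptotic subset
    Omega is C-bi-Lipschitz to a compact K of positive measure in R^k, with
    k > n.  At some place and scale K nearly fills a cube: for every m there is
    a cube of side m s each point of which is s-close to K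
    ([positive_measure_dense_cube]).  Sending a point of the cube to a nearby
    point of K, then to Omega, then to a Gromov-Hausdorff close point of the
    rescaled X_i, gives a map that is a quasi-isometric embedding with the fixed
    multiplicative constant C and an additive error of order C k s
    ([coarse_cube_embedding]).  In the unscaled metric of X_i the cube has side
    t = r_i m s and the additive error is a = O(r_i s), which is a fraction
    O(1 / m) of t.  As the constant D belongs to L = C alone, m can be chosen
    after D and large enough for the lower bound on a to fail as soon as r_i is
    large.

    The cube exists for an elementary reason: if every cube had a
    subcube of the m-grid disjoint from K, then discarding these subcubes
    repeatedly would cover K by (m^k - 1)^j cubes of side T / m^j, of total
    volume tending to 0. *)

Set Implicit Arguments.
Unset Strict Implicit.
Unset Printing Implicit Defensive.

Import Order.TTheory GRing.Theory Num.Theory.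
Import numFieldNormedType.Exports.

Local Open Scope classical_set_scope.
Local Open Scope ring_scope.

(** * Euclidean distance *)

(** Expand the square in [\sum_i (B u_i - A v_i)^2 >= 0], where A and B are the
    norms of u and v; the degenerate cases A = 0 and B = 0 are separate. *)
Lemma cauchy_schwarz_sum (R : realType) (k : nat) (u v : 'I_k -> R) :
  \sum_i u i * v i <=
    Num.sqrt (\sum_i u i ^+ 2) * Num.sqrt (\sum_i v i ^+ 2).
Proof.
have sq_ge0 (w : 'I_k -> R) : 0 <= \sum_i w i ^+ 2.
  by apply: sumr_ge0 => i _; exact: sqr_ge0.
have sqrt0 (w : 'I_k -> R) : Num.sqrt (\sum_i w i ^+ 2) = 0 ->
    forall i, w i = 0.
  move=> /eqP; rewrite sqrtr_eq0 => w0 i.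
  have /eqP : \sum_i w i ^+ 2 = 0 by apply/le_anti; rewrite w0 sq_ge0.
  rewrite psumr_eq0 => [/allP/(_ i)|j _]; last exact: sqr_ge0.
  by rewrite mem_index_enum sqrf_eq0 => /(_ isT)/eqP.
set A := Num.sqrt (\sum_i u i ^+ 2); set B := Num.sqrt (\sum_i v i ^+ 2).
have [A0|A0] := eqVneq A 0.
  by rewrite A0 mul0r big1 // => i _; rewrite (sqrt0 _ A0) mul0r.
have [B0|B0] := eqVneq B 0.
  by rewrite B0 mulr0 big1 // => i _; rewrite (sqrt0 _ B0) mulr0.
have AB : 0 < A * B by rewrite mulr_gt0 // lt_def sqrtr_ge0 ?A0 ?B0.
have : 0 <= \sum_i (B * u i - A * v i) ^+ 2 by apply: sq_ge0.
have -> : \sum_i (B * u i - A * v i) ^+ 2 =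
    B ^+ 2 * (\sum_i u i ^+ 2) - 2 * (A * B) * (\sum_i u i * v i)
      + A ^+ 2 * (\sum_i v i ^+ 2).
  rewrite !mulr_sumr -sumrB -big_split /=; apply: eq_bigr => i _; ring.
rewrite -(sqr_sqrtr (sq_ge0 u)) -(sqr_sqrtr (sq_ge0 v)) -/A -/B => h.
rewrite -(ler_pM2l AB) -subr_ge0; lra.
Qed.

Section EuclideanDistance.
Variables (R : realType) (k : nat).
Implicit Types x y z p : 'rV[R]_k.

Lemma eucl_dist_ge0 x y : 0 <= eucl_dist x y.
Proof. exact: sqrtr_ge0. Qed.

Lemma eucl_distC x y : eucl_dist x y = eucl_dist y x.
Proof.
by congr Num.sqrt; apply: eq_bigr => i _; rewrite -sqrrN opprB.
Qed.

Lemma eucl_dist_triangle x y z :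
  eucl_dist x z <= eucl_dist x y + eucl_dist y z.
Proof.
have sq_ge0 (w : 'I_k -> R) : 0 <= \sum_i w i ^+ 2.
  by apply: sumr_ge0 => i _; exact: sqr_ge0.
have S0 : 0 <= eucl_dist x y + eucl_dist y z by rewrite addr_ge0 ?eucl_dist_ge0.
rewrite -[leRHS]ger0_norm // -sqrtr_sqr ler_wsqrtr // sqrrD.
rewrite !sqr_sqrtr //.
have := cauchy_schwarz_sum (fun i => x 0 i - y 0 i) (fun i => y 0 i - z 0 i).
rewrite -[Num.sqrt _]/(eucl_dist x y) -[Num.sqrt _]/(eucl_dist y z) => CS.
have -> : \sum_i (x 0 i - z 0 i) ^+ 2 = \sum_i (x 0 i - y 0 i) ^+ 2 +
    (\sum_i (x 0 i - y 0 i) * (y 0 i - z 0 i)) *+ 2 +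
    \sum_i (y 0 i - z 0 i) ^+ 2.
  by rewrite -sumrMnl -!big_split /=; apply: eq_bigr => i _; ring.
by rewrite lerD2r lerD2l lerMn2r CS orbT.
Qed.

Lemma ler_coord_eucl_dist x y i : `|x 0 i - y 0 i| <= eucl_dist x y.
Proof.
rewrite -sqrtr_sqr ler_wsqrtr // (bigD1 i) //= lerDl.
by apply: sumr_ge0 => j _; exact: sqr_ge0.
Qed.

Lemma eucl_dist_le_coord x y e : 0 <= e ->
  (forall i, `|x 0 i - y 0 i| <= e) -> eucl_dist x y <= k%:R * e.
Proof.
move=> e0 xy; have ke : 0 <= k%:R * e by rewrite mulr_ge0.
rewrite -[leRHS]ger0_norm // -sqrtr_sqr ler_wsqrtr //.
apply: (@le_trans _ _ (\sum_(i < k) e ^+ 2)).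
  by apply: ler_sum => i _; rewrite -real_normK ?num_real // lerXn2r ?nnegrE.
rewrite sumr_const card_ord -[leLHS]mulr_natl exprMn.
apply: ler_wpM2r; first exact: sqr_ge0.
by rewrite -natrX ler_nat; case: (k) => // j; rewrite -mulnn leq_pmulr.
Qed.

Lemma eucl_dist_affine x y p (c : R) : 0 <= c ->
  eucl_dist (p + c *: x) (p + c *: y) = c * eucl_dist x y.
Proof.
move=> c0; rewrite /eucl_dist.
rewrite -[in RHS](ger0_norm c0) -sqrtr_sqr -sqrtrM ?sqr_ge0 // mulr_sumr.
by congr Num.sqrt; apply: eq_bigr => i _; rewrite !mxE; ring.
Qed.

End EuclideanDistance.

(** * Cubes in a set of positive measure *)

Section Cubes.
Variables (R : realType) (k : nat).
Implicit Types (x y p q : 'rV[R]_k) (s : R) (K : set 'rV[R]_k).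

Definition cube p s : set 'rV[R]_k := box p (p + const_mx s).

Definition grid_point (m : nat) p s (u : {ffun 'I_k -> 'I_m}) : 'rV[R]_k :=
  \row_i (p 0 i + (u i)%:R * s).

Lemma cubeP p s x :
  cube p s x <-> forall i, p 0 i <= x 0 i <= p 0 i + s.
Proof. by split=> h i; have := h i; rewrite !mxE. Qed.

Lemma grid_interval (m : nat) (x s : R) : (0 < m)%N -> 0 <= x <= m%:R * s ->
  exists u : 'I_m, u%:R * s <= x <= u%:R * s + s.
Proof.
elim: m => // m IH _ /andP[x0 xm].
have [xs|xs] := lerP (m%:R * s) x.
  by exists ord_max; rewrite xs /=; move: xm; rewrite -natr1; lra.
have [m0|m0] := posnP m; first by move: xs; rewrite m0 mul0r ltNge x0.
have [|u hu] := IH m0; first by rewrite x0 ltW.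
by exists (widen_ord (leqnSn m) u).
Qed.

Lemma cube_grid (m : nat) p s x : (0 < m)%N -> cube p (m%:R * s) x ->
  exists u : {ffun 'I_k -> 'I_m}, cube (grid_point p s u) s x.
Proof.
move=> m0 /cubeP hx.
have /choice[u hu] : forall i, exists v : 'I_m,
    v%:R * s <= x 0 i - p 0 i <= v%:R * s + s.
  by move=> i; apply: grid_interval => //; have := hx i; lra.
exists [ffun i => u i]; apply/cubeP => i; rewrite mxE ffunE.
by have := hu i; lra.
Qed.

(** If every cube misses K in one of its m^k grid subcubes, then the m^k - 1
    others suffice, and the same can be said inside each of them: every
    refinement by a factor m multiplies the number of cubes by m^k - 1 only. *)
Lemma porous_cover (m : nat) K : (0 < m)%N ->
  (forall p s, 0 < s -> exists u : {ffun 'I_k -> 'I_m},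
     forall x, K x -> ~ cube (grid_point p s u) s x) ->
  forall (j : nat) p s, 0 < s -> exists c : seq 'rV[R]_k,
    (size c <= (m ^ k).-1 ^ j)%N /\
    forall x, K x -> cube p ((m ^ j)%:R * s) x ->
      exists2 q, q \in c & cube q s x.
Proof.
move=> m0 porous; elim=> [|j IH] p s s0.
  exists [:: p]; split => // x _; rewrite expn0 mul1r => xp.
  by exists p; rewrite ?mem_head.
have S0 : 0 < (m ^ j)%:R * s by rewrite mulr_gt0 // ltr0n expn_gt0 m0.
have [u0 hu0] := porous p _ S0.
have /choice[c hc] := fun u : {ffun 'I_k -> 'I_m} =>
  IH (grid_point p ((m ^ j)%:R * s) u) s s0.
exists (flatten [seq c u | u <- enum (predC1 u0)]); split.
  rewrite size_flatten /shape -map_comp sumnE big_map big_enum /=.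
  apply: (@leq_trans (\sum_(u in predC1 u0) (m ^ k).-1 ^ j)).
    by apply: leq_sum => u _; exact: (hc u).1.
  by rewrite sum_nat_const cardC1 card_ffun !card_ord expnS.
move=> x Kx; rewrite expnS natrM -mulrA => /(cube_grid m0)[u xu].
have [q qc xq] := (hc u).2 x Kx xu.
exists q => //; apply/flatten_mapP; exists u => //.
rewrite mem_enum inE; apply/eqP => uu0; apply: hu0 Kx _.
by rewrite -uu0.
Qed.

(** A finite cover is a cover indexed by an initial segment of the integers, so
    that the extended sum of volumes becomes a finite one. *)
Lemma lebesgue_outer_cube_cover K s (c : seq 'rV[R]_k) : 0 <= s ->
  (forall x, K x -> exists2 q, q \in c & cube q s x) ->
  (lebesgue_outer K <= ((size c)%:R * s ^+ k)%:E)%E.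
Proof.
move=> s0 cover; apply: ereal_inf_lbound.
exists `I_(size c), (fun j => c`_j), (fun j => c`_j + const_mx s); split.
- by move=> j i; rewrite !mxE lerDl.
- move=> x /cover[q qc xq]; exists (index q c); first by rewrite /= index_mem.
  by rewrite nth_index.
- have vol j : box_volume c`_j (c`_j + const_mx s) = s ^+ k.
    rewrite /box_volume (eq_bigr (fun=> s)) ?prodr_const ?card_ord // => i _.
    by rewrite !mxE addrAC subrr add0r.
  rewrite esum_fset => [||j _]; first last.
  + by rewrite vol lee_fin exprn_ge0.
  + exact: finite_II.
  rewrite -fsbig_ord.
  under eq_bigr do rewrite vol.
  by rewrite sumEFin sumr_const card_ord mulr_natl.
Qed.

(** After j refinements the covering cubes have total volume
    T^k ((m^k - 1) / m^k)^j, a geometric sequence of ratio less than 1. *)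
Lemma porous_null (m : nat) K p T : (0 < m)%N -> 0 < T -> K `<=` cube p T ->
  (forall p s, 0 < s -> exists u : {ffun 'I_k -> 'I_m},
     forall x, K x -> ~ cube (grid_point p s u) s x) ->
  (lebesgue_outer K <= 0)%E.
Proof.
move=> m0 T0 KT porous; apply/lee_addgt0Pr => e e0; rewrite add0e.
set N := (m ^ k)%N; have N0 : (0 < N)%N by rewrite expn_gt0 m0.
pose z : R := N.-1%:R / N%:R.
have z1 : `|z| < 1.
  rewrite ger0_norm ?divr_ge0 // ltr_pdivrMr ?ltr0n // mul1r ltr_nat.
  by rewrite prednK.
have [j _ hj] : \forall j \near \oo, T ^+ k * z ^+ j < e.
  have := @cvg_geometric R (T ^+ k) z z1.
  move=> /cvgrPdist_lt /(_ e e0); apply: filterS => j /=.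
  by rewrite sub0r normrN; apply: le_lt_trans; exact: ler_norm.
have {}hj : T ^+ k * z ^+ j < e by apply: hj => /=.
have mj0 : 0 < (m ^ j)%:R :> R by rewrite ltr0n expn_gt0 m0.
pose s := T / (m ^ j)%:R.
have s0 : 0 < s by rewrite divr_gt0.
have [c [sc cover]] := porous_cover m0 porous j p s0.
apply: (@le_trans _ _ ((size c)%:R * s ^+ k)%:E).
  apply: lebesgue_outer_cube_cover (ltW s0) _ => x Kx; apply: cover => //.
  by rewrite /s mulrC divfK ?gt_eqF //; exact: KT.
rewrite lee_fin (le_trans _ (ltW hj)) //.
have -> : T ^+ k * z ^+ j = (N.-1 ^ j)%:R * s ^+ k.
  rewrite /z /s !expr_div_n natrX mulrCA; congr (_ * (_ * _^-1)).
  by rewrite /N !natrX -!exprM mulnC.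
by rewrite ler_wpM2r ?exprn_ge0 ?(ltW s0) // ler_nat.
Qed.

Lemma compact_sub_cube K : compact K ->
  exists p T, 0 < T /\ K `<=` cube p T.
Proof.
move=> /compact_bounded[M [_ hM]].
pose B := `|M| + 1.
have B0 : 0 < B by rewrite ltr_wpDl.
exists (const_mx (- B)), (2 * B); split; first by rewrite mulr_gt0.
move=> x Kx; apply/cubeP => i; rewrite mxE.
have : `|x 0 i| <= B.
  apply: le_trans (hM B _ x Kx); last by rewrite ltr_pwDr // ler_norm.
  rewrite /Num.norm /= mx_normrE.
  by apply: (le_bigmax _ (fun ij : 'I_1 * 'I_k => `|x ij.1 ij.2|) (0, i)).
by rewrite ler_norml; lra.
Qed.

(** A weak form of the existence of density points, sufficient for the purpose
    because the relative precision 1 / m is fixed in advance: by [porous_null],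
    K cannot be porous at every place and scale, and a cube all of whose grid
    subcubes meet K is the one sought. *)
Lemma positive_measure_dense_cube K (m : nat) :
  compact K -> (0 < lebesgue_outer K)%E -> (0 < m)%N ->
  exists p s, 0 < s /\ forall x, cube p (m%:R * s) x ->
    exists2 y, K y & forall i, `|x 0 i - y 0 i| <= s.
Proof.
move=> cK posK m0; apply: contrapT => noncube.
have [p [T [T0 KT]]] := compact_sub_cube cK.
suff : (lebesgue_outer K <= 0)%E by rewrite leNgt posK.
apply: (porous_null m0 T0 KT) => {p T T0 KT}p s s0.
apply: contrapT => full; apply: noncube; exists p, s; split => // x.
move=> /(cube_grid m0)[u /cubeP xu]; apply: contrapT => far.
apply: full; exists u => y Ky /cubeP yu; apply: far; exists y => // i.
by rewrite ler_norml; have := xu i; have := yu i; lra.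
Qed.

End Cubes.

(** * Gromov-Hausdorff approximation *)

Lemma within_distance_lt (R : realType) (X : metricType R) (t d : R)
    (A B : set X) (x : X) :
  within_distance t A B -> t < d -> A x -> exists2 y, B y & mdist x y < d.
Proof.
move=> AB td Ax.
have /ereal_inf_lt[_ [y By <-] xy] : (edist_inf B x < d%:E)%E.
  by rewrite (le_lt_trans (AB x Ax)) // lte_fin.
by exists y => //; have := edist_lt_ball xy; rewrite ballEmdist.
Qed.

(** In a common metric space realising the Gromov-Hausdorff distance up to d,
    choose for each point of T a d-close point of A; two triangle inequalities
    bound the distortion. *)
Lemma gh_dist_approx (R : realType) (S T : Type) (A : set S)
    (dA : S -> S -> R) (dB : T -> T -> R) (d : R) :
  (gh_dist A dA [set: T] dB < d%:E)%E ->
  exists q : T -> S, forall w w', `|dA (q w) (q w') - dB w w'| <= 2 * d.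
Proof.
move=> /ereal_inf_lt[_ [Z [phi [psi [isoA isoB ->]]]]].
move=> /ereal_inf_lt[_ [e [_ _ BA] <-]]; rewrite lte_fin => ed.
have /choice[q hq] : forall w, exists y, A y /\ mdist (psi w) (phi y) < d.
  move=> w; have [|_ [y Ay <-] wy] := within_distance_lt BA ed (x := psi w).
    by exists w.
  by exists y.
exists q => w w'.
have [[Aw dw] [Aw' dw']] := (hq w, hq w').
rewrite -(isoA _ _ Aw Aw') -(isoB w w') // ler_norml.
have := metric_triangle (psi w) (phi (q w)) (psi w').
have := metric_triangle (phi (q w)) (phi (q w')) (psi w').
have := metric_triangle (phi (q w)) (psi w) (phi (q w')).
have := metric_triangle (psi w) (psi w') (phi (q w')).
rewrite (metric_sym (phi (q w)) (psi w)) (metric_sym (phi (q w')) (psi w')).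
lra.
Qed.

(** The composite of three maps: the chart x |-> p + x / r onto the cube where K
    is s-dense, a choice of nearby points in K read in Omega through g, and the
    approximation q.  Moving to K costs at most k s in Euclidean distance at
    each end, q costs 2 d, and the final rescaling multiplies both by r; only
    the bi-Lipschitz constant C of g remains as a multiplicative constant. *)
Lemma coarse_cube_embedding (R : realType) (k : nat) (K : set 'rV[R]_k)
    (Omega X : metricType R) (g : Omega -> 'rV[R]_k) (q : Omega -> X)
    (C r d s T : R) (p : 'rV[R]_k) :
  1 <= C -> 0 < r -> 0 <= s -> 0 <= T ->
  (forall x, cube p T x -> exists2 y, K y & forall i, `|x 0 i - y 0 i| <= s) ->
  g @` [set: Omega] = K ->
  (forall w w', C^-1 * mdist w w' <= eucl_dist (g w) (g w') <= C * mdist w w') ->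
  (forall w w', `|r^-1 * mdist (q w) (q w') - mdist w w'| <= 2 * d) ->
  exists f : 'rV[R]_k -> X,
    qi_embedding C (2 * r * (C * (k%:R * s) + d)) (cube 0 (r * T))
      (@eucl_dist R k) f.
Proof.
move=> C1 r0 s0 T0 dense gK gC qd.
have C0 : 0 < C by rewrite (lt_le_trans ltr01).
pose chart x : 'rV[R]_k := p + r^-1 *: x.
have near_K x : cube p T x -> exists w, eucl_dist x (g w) <= k%:R * s.
  move=> /dense[y]; rewrite -gK => -[w _ <-] xw.
  by exists w; exact: eucl_dist_le_coord.
have [w0 _] : exists w, eucl_dist p (g w) <= k%:R * s.
  by apply: near_K; apply/cubeP => i; rewrite lexx lerDl.
have /choice[h hh] : forall x, exists w,
    cube 0 (r * T) x -> eucl_dist (chart x) (g w) <= k%:R * s.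
  move=> x; have [/cubeP hx|?] := pselect (cube 0 (r * T) x); last by exists w0.
  have [|w xw] := near_K (chart x); last by exists w.
  apply/cubeP => i; have := hx i; rewrite !mxE add0r lerDl lerD2l.
  by rewrite ler_pdivrMl // pmulr_rge0 // invr_gt0.
exists (q \o h) => x y Wx Wy /=.
set M := mdist (h x) (h y); set Q := mdist _ _.
set G := eucl_dist (g (h x)) (g (h y)); set eta := k%:R * s.
have E : eucl_dist (chart x) (chart y) = r^-1 * eucl_dist x y.
  by apply: eucl_dist_affine; rewrite invr_ge0 ltW.
have [xh yh] := (hh x Wx, hh y Wy).
have GE : G <= r^-1 * eucl_dist x y + 2 * eta.
  have := eucl_dist_triangle (g (h x)) (chart x) (g (h y)).
  have := eucl_dist_triangle (chart x) (chart y) (g (h y)).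
  by rewrite E (eucl_distC (g (h x)) (chart x)) -/G -/eta in xh yh *; lra.
have EG : r^-1 * eucl_dist x y - 2 * eta <= G.
  have := eucl_dist_triangle (chart x) (g (h x)) (chart y).
  have := eucl_dist_triangle (g (h x)) (g (h y)) (chart y).
  by rewrite E (eucl_distC (g (h y)) (chart y)) -/G -/eta in xh yh *; lra.
have MG : C^-1 * G <= M <= C * G.
  have := gC (h x) (h y); rewrite -/M -/G => /andP[MG GM].
  by rewrite ler_pdivrMl // GM -ler_pdivrMl.
have /andP[QM MQ] : r * (M - 2 * d) <= Q <= r * (M + 2 * d).
  have := qd (h x) (h y); rewrite -/M -/Q ler_norml => /andP[qM Mq].
  by apply/andP; split; [rewrite -ler_pdivlMl|rewrite -ler_pdivrMl] => //; lra.
have eta0 : 0 <= eta by rewrite mulr_ge0.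
have Ci : C^-1 <= C by rewrite (le_trans _ C1) // invf_le1.
set e := r^-1 * eucl_dist x y in GE EG *.
have -> : eucl_dist x y = r * e by rewrite mulVKf ?gt_eqF.
case/andP: MG => GM MG; apply/andP; split.
  apply: le_trans QM.
  apply: (@le_trans _ _ (r * (C^-1 * (e - 2 * eta) - 2 * d))).
    have : r * (C^-1 * eta) <= r * (C * eta) by rewrite ler_pM2l // ler_wpM2r.
    lra.
  rewrite ler_pM2l // lerD2r (le_trans _ GM) // ler_pM2l ?invr_gt0 //.
apply: (le_trans MQ).
apply: (@le_trans _ _ (r * (C * (e + 2 * eta) + 2 * d))).
  by rewrite ler_pM2l // lerD2r (le_trans MG) // ler_pM2l.
lra.
Qed.

(** * The corner simplex *)

Section CornerSimplex.
Variables (R : realType) (n k : nat) (t : R).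
Hypotheses (nk : (n < k)%N) (t0 : 0 < t).

(** The vertices 0, t e_1, ..., t e_(n+1) of a simplex in R^k.  The right-angled
    simplex makes all estimates readable on single coordinates: up to the factor
    t, the coordinates of a point are its barycentric coordinates, except the
    one at the origin. *)
Definition corner (i : 'I_n.+2) : 'rV[R]_k :=
  \row_(j < k) (if i == j.+1 :> nat then t else 0).

Lemma corner_coord (c : 'I_n.+2 -> R) (i : 'I_n.+1) :
  (\sum_l c l *: corner l) 0 (widen_ord nk i) = c (lift ord0 i) * t.
Proof.
rewrite summxE (bigD1 (lift ord0 i)) //= !mxE /= eqxx big1 ?addr0 // => l li.
rewrite !mxE /=; case: eqP => [E|_]; last by rewrite mulr0.
by case/eqP: li; apply: val_inj => /=; rewrite E.
Qed.

Lemma corner_independent : affinely_independent corner.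
Proof.
move=> c c0 cv.
have cS i : c (lift ord0 i) = 0.
  apply/eqP; have := corner_coord c i; rewrite cv mxE => /esym/eqP.
  by rewrite mulf_eq0 (gt_eqF t0) orbF.
move=> i; case: (unliftP ord0 i) => [j|] -> //.
by move: c0; rewrite big_ord_recl big1 ?addr0.
Qed.

Lemma facet_corner_sub_cube i : facet corner i `<=` cube 0 t.
Proof.
move=> _ [c [c0 _ c1 ->]]; apply/cubeP => j; rewrite mxE add0r summxE.
apply/andP; split.
  apply: sumr_ge0 => l _; rewrite !mxE mulr_ge0 //.
  by case: ifP => // _; exact: ltW.
rewrite -[leRHS]mul1r -c1 mulr_suml; apply: ler_sum => l _.
by rewrite !mxE ler_wpM2l //; case: ifP => // _; exact: ltW.
Qed.

(** The facet opposite to t e_j lies in the hyperplane where the j-th coordinate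
    vanishes, while all the first n+1 coordinates of the barycentre of the facet
    opposite to the origin are t / (n+1). *)
Lemma corner_barycenter_far : exists2 x, facet corner ord0 x &
  forall i y, i != ord0 -> facet corner i y -> t / n.+1%:R <= eucl_dist x y.
Proof.
pose c (l : 'I_n.+2) : R := if l == ord0 then 0 else n.+1%:R^-1.
exists (\sum_l c l *: corner l).
  exists c; split => // [l|].
    by rewrite /c; case: ifP => //; rewrite invr_ge0.
  rewrite big_ord_recl /c eqxx add0r (eq_bigr (fun=> n.+1%:R^-1)) //.
  by rewrite sumr_const card_ord -[LHS]mulr_natl divff ?pnatr_eq0.
move=> i y; case: (unliftP ord0 i) => [j ->|->]; last by rewrite eqxx.
move=> _ [b [_ bj _ ->]].
apply: le_trans (ler_coord_eucl_dist _ _ (widen_ord nk j)).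
by rewrite !corner_coord bj mul0r subr0 mulrC; exact: ler_norm.
Qed.

End CornerSimplex.

(** * The rank bound *)

(** The slim simplex condition bounds the size of quasi-isometrically embedded
    cubes of dimension greater than n: the corner simplex fits in the cube, and the
    barycentre of one of its facets cannot be mapped close to the others. *)
Lemma SS_cube_scale (R : realType) (n k : nat) (L D a t : R)
    (X : metricType R) (f : 'rV[R]_k -> X) :
  (n < k)%N -> 1 <= L -> 0 <= a -> 0 < t -> SS n L D X ->
  qi_embedding L a (cube 0 t) (@eucl_dist R k) f ->
  L^-1 * (t / n.+1%:R) <= D * (1 + a) + a.
Proof.
move=> nk L1 a0 t0 ss qi.
have L0 : 0 < L by rewrite (lt_le_trans ltr01).
have sub := @facet_corner_sub_cube R n k t t0.
have [x x0 far] := @corner_barycenter_far R n k t nk.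
pose v := @corner R n k t.
have thin : within_distance (D * (1 + a)) (f @` facet v ord0)
    (\bigcup_(i in [set i | i != ord0]) f @` facet v i).
  apply: (ss _ _ _ _ a0 (corner_independent nk t0) _ ord0).
  by move=> j y z /sub yj /sub zj; exact: qi.
apply/ler_addgt0Pr => e e0.
have [||_ [i /= i0 [y yi <-]]] :=
    within_distance_lt thin (d := D * (1 + a) + e) (x := f x).
- by rewrite ltrDl.
- by exists x.
have /andP[lo _] := qi x y (sub _ _ x0) (sub _ _ yi).
have : L^-1 * (t / n.+1%:R) <= L^-1 * eucl_dist x y.
  by rewrite ler_pM2l ?invr_gt0 // (far i).
by move=> /le_trans le_d /ltW xy; apply: le_d; lra.
Qed.

Theorem proposition7p4 (R : realType) (X : nat -> metricType R) (n : nat)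
    (hn : (1 <= n)%N)
    (hSS : forall L : R, 1 <= L ->
       exists2 D : R, 0 <= D & forall i : nat, SS n L D (X i)) :
  (asymptotic_rank X <= (n%:R)%:E)%E.
Proof.
apply: ge_ereal_sup => _ [k hk <-]; case: hk => Omega [K [g [asym cK posK [gK [C C1 gC]]]]].
rewrite lee_fin ler_nat leqNgt; apply/negP => nk.
have C0 : 0 < C by rewrite (lt_le_trans ltr01).
have k0 : 0 < k%:R :> R by rewrite ltr0n (leq_trans _ nk).
have [D D0 ss] := hSS C C1.
(* With s the fineness of K in the cube, the additive error will be
   a = 4 r (C k s); B is the value of m at which the size r m s / (C (n+1)) in
   [SS_cube_scale] equals (D + 1) a + r s, and r s will exceed D. *)
pose B := C * n.+1%:R * (4 * (D + 1) * (C * k%:R) + 1).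
have B0 : 0 < B.
  by rewrite mulr_gt0 ?mulr_gt0 // ltr_wpDl // !mulr_ge0 ?addr_ge0 // ltW.
have [m mB] : exists m : nat, B < m%:R.
  by exists (Num.bound B); rewrite archi_boundP // ltW.
have m0 : (0 < m)%N by rewrite -(ltr0n R) (lt_trans B0).
have [p [s [s0 dense]]] := positive_measure_dense_cube cK posK m0.
(* The Gromov-Hausdorff error is allowed to be as large as the error already
   made by moving to K. *)
pose d := C * (k%:R * s).
have d0 : 0 < d by rewrite !mulr_gt0.
case: asym => _ [r [Y [r0 r_oo gh0]]].
have [i /= [gh_d r_large]] : exists i,
    (gh_dist (Y i) (fun x y => ((r i)^-1 * mdist x y)%R) [set: Omega]
       (@mdist R Omega) < d%:E)%E /\ (D / s < r i)%R.
  have gh_d : \forall i \near \oo,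
      (gh_dist (Y i) (fun x y => ((r i)^-1 * mdist x y)%R) [set: Omega]
        (@mdist R Omega) < d%:E)%E.
    have nbhs_d : nbhs (0%:E : \bar R) [set y | (y < d%:E)%E].
      apply: open_nbhs_nbhs; split; first exact: open_ereal_lt_ereal.
      by rewrite /= lte_fin.
    exact: gh0 nbhs_d.
  have /cvgryPgt/(_ (D / s)) r_large := r_oo.
  have [i] := filter_ex (filterI gh_d r_large).
  by exists i.
have [q qd] := gh_dist_approx gh_d.
have T0 : 0 < m%:R * s by rewrite mulr_gt0 ?ltr0n.
have [f qi] := coarse_cube_embedding C1 (r0 i) (ltW s0) (ltW T0) dense gK gC qd.
have a0 : 0 <= 2 * r i * (C * (k%:R * s) + d).
  by rewrite mulr_ge0 ?mulr_ge0 ?addr_ge0 // ltW.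
have := SS_cube_scale nk C1 a0 (mulr_gt0 (r0 i) T0) (ss i) qi.
apply/negP; rewrite -ltNge.
have rsD : D < r i * s by rewrite -ltr_pdivrMr.
have rs0 : 0 < r i * s by rewrite mulr_gt0.
have : (r i * s) * (4 * (D + 1) * (C * k%:R) + 1) <
    C^-1 * (r i * (m%:R * s) / n.+1%:R).
  have -> : C^-1 * (r i * (m%:R * s) / n.+1%:R) =
      (r i * s) * (m%:R / (C * n.+1%:R)).
    by rewrite [(C * _)^-1]invfM; ring.
  by rewrite ltr_pM2l // ltr_pdivlMr ?mulr_gt0 // mulrC.
apply: lt_trans; rewrite /d; lra.
Qed.
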